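(* Let $\mathbb K$ be $\mathbb R$ or $\mathbb C$. Let $f=A+\sum_{j\geq 2}f_j$ be a formal power series vector field on $\mathbb K^n$, where $A\in\mathbb K^{(n,n)}$ and each $f_j$ is homogeneous of degree $j$, such that the eigenvalues $\lambda_1,\ldots,\lambda_n$ of $A$ satisfy no resonance equation $\sum_i m_i\lambda_i-\lambda_j=0$ with $j\in\{1,\ldots,n\}$ and integers $m_i\geq 0$, $\sum_i m_i\geq 2$. If $g$ is a formal vector field such that $[g,f]=\alpha f$ with some formal power series $\alpha$, then $g=h+\beta f$ with some formal power series $\beta$ and some formal vector field $h$ satisfying $[h,f]=0$.
   Context: A formal vector field on $\mathbb K^n$ is an element of $\mathbb K[[x_1,\ldots,x_n]]^n$; a formal power series is an element of $\mathbb K[[x_1,\ldots,x_n]]$. The matrix $A$ is identified with the linear vector field $x\mapsto Ax$; its eigenvalues are taken in $\mathbb C$, with multiplicity. The Lie bracket is $[f,g]=Dg\, f-Df\, g$. *)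

(* Defs.v *)
From HB Require Import structures.
From mathcomp Require Import all_boot all_order all_algebra.
From mathcomp Require Import boolp reals complex mpoly.

Set Implicit Arguments.
Unset Strict Implicit.
Unset Printing Implicit Defensive.

Import GRing.Theory.

Local Open Scope ring_scope.

(* A formal power series is its family of coefficients, indexed by the
   monomials ['X_{1..n}] of the polynomial library; a wrapper type is used so
   that the product is the Cauchy product and not the pointwise one. *)
Record fps (K : Type) (n : nat) := FPS { fcoeff :> 'X_{1..n} -> K }.

Section FormalPowerSeries.
Context {K : comNzRingType} {n : nat}.
Implicit Types (p q r : fps K n) (m : 'X_{1..n}) (c : K).

HB.instance Definition _ := gen_eqMixin (fps K n).
HB.instance Definition _ := gen_choiceMixin (fps K n).

Lemma fpsP p q : fcoeff p =1 fcoeff q <-> p = q.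
Proof.
split=> [|-> //]; case: p q => [p] [q] /= e.
by congr FPS; apply: funext.
Qed.

Definition fpsC c : fps K n := FPS (fun m => if m == 0%MM then c else 0).
Definition fpsX (i : 'I_n) : fps K n := FPS (fun m => (m == U_(i)%MM)%:R).

Definition fps_opp p : fps K n := FPS (fun m => - p m).
Definition fps_add p q : fps K n := FPS (fun m => p m + q m).

(* The degree bound only makes the index type finite; it excludes no pair. *)
Definition fps_mul p q : fps K n :=
  FPS (fun m =>
    \sum_(k : 'X_{1..n < (mdeg m).+1, (mdeg m).+1} | m == (k.1 + k.2)%MM)
      p k.1 * q k.2).

Fact fps_addA : associative fps_add.
Proof. by move=> p q r; apply/fpsP=> m /=; rewrite addrA. Qed.

Fact fps_addC : commutative fps_add.
Proof. by move=> p q; apply/fpsP=> m /=; rewrite addrC. Qed.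

Fact fps_add0 : left_id (fpsC 0) fps_add.
Proof. by move=> p; apply/fpsP=> m /=; rewrite if_same add0r. Qed.

Fact fps_addN : left_inverse (fpsC 0) fps_opp fps_add.
Proof. by move=> p; apply/fpsP=> m /=; rewrite if_same addNr. Qed.

HB.instance Definition _ :=
  GRing.isZmodule.Build (fps K n) fps_addA fps_addC fps_add0 fps_addN.

Definition fps_trunc d p : {mpoly K[n]} :=
  \sum_(m : 'X_{1..n < d}) p m *: 'X_[m].

Lemma mcoeff_fps_trunc d p m : (mdeg m < d)%N -> (fps_trunc d p)@_m = p m.
Proof. exact: mcoeff_mpoly. Qed.

Lemma fps_mul_eq p q (P Q : {mpoly K[n]}) m :
    (forall k, (mdeg k <= mdeg m)%N -> P@_k = p k) ->
    (forall k, (mdeg k <= mdeg m)%N -> Q@_k = q k) ->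
  fps_mul p q m = (P * Q)@_m.
Proof.
move=> hP hQ; rewrite mcoeffM /=; apply: eq_bigr => k _.
by rewrite hP ?hQ // -ltnS bmdeg.
Qed.

Lemma fps_mul_trunc d p q m : (mdeg m < d)%N ->
  fps_mul p q m = (fps_trunc d p * fps_trunc d q)@_m.
Proof.
by move=> md; apply: fps_mul_eq => k km; apply: mcoeff_fps_trunc;
  apply: leq_ltn_trans md.
Qed.

Fact fps_mulA : associative fps_mul.
Proof.
move=> p q r; apply/fpsP=> m; pose t := fps_trunc (mdeg m).+1.
have ht s k : (mdeg k <= mdeg m)%N -> (t s)@_k = s k.
  by move=> km; apply: mcoeff_fps_trunc.
rewrite (@fps_mul_eq p _ (t p) (t q * t r)); first last.
- by move=> k km; rewrite -fps_mul_trunc.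
- exact: ht.
rewrite (@fps_mul_eq _ r (t p * t q) (t r)) ?mulrA //.
- by move=> k km; rewrite -fps_mul_trunc.
- exact: ht.
Qed.

Fact fps_mulC : commutative fps_mul.
Proof.
by move=> p q; apply/fpsP=> m; rewrite !(@fps_mul_trunc (mdeg m).+1) // mulrC.
Qed.

Fact fps_mul1 : left_id (fpsC 1) fps_mul.
Proof.
move=> p; apply/fpsP=> m.
rewrite (@fps_mul_eq _ _ 1 (fps_trunc (mdeg m).+1 p)).
- by rewrite mul1r mcoeff_fps_trunc.
- by move=> k _; rewrite mcoeff1 /=; case: eqP.
- by move=> k km; apply: mcoeff_fps_trunc.
Qed.

Fact fps_mulDl : left_distributive fps_mul +%R.
Proof.
move=> p q r; apply/fpsP=> m /=; rewrite -big_split /=.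
by apply: eq_bigr => k _; rewrite mulrDl.
Qed.

Fact fps_1_neq0 : fpsC 1 != 0.
Proof. by apply/eqP => /fpsP/(_ 0%MM) /= /eqP; rewrite eqxx oner_eq0. Qed.

HB.instance Definition _ :=
  GRing.Zmodule_isComNzRing.Build (fps K n)
    fps_mulA fps_mulC fps_mul1 fps_mulDl fps_1_neq0.

Definition fps_deriv (i : 'I_n) p : fps K n :=
  FPS (fun m => p (m + U_(i))%MM *+ (m i).+1).

Definition fps_homog (d : nat) p : Prop := forall m, mdeg m != d -> p m = 0.

End FormalPowerSeries.

(* Formal vector fields on K^n are column vectors of formal power series. *)
Notation fvf K n := 'cV[fps K n]_n.

Section FormalVectorFields.
Context {K : comNzRingType} {n : nat}.
Implicit Types (f g : fvf K n) (A : 'M[K]_n).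

Definition linear_fvf A : fvf K n := map_mx fpsC A *m (\col_j fpsX j).

Definition fvf_homog (d : nat) f : Prop := forall i, fps_homog d (f i 0).

(* The infinite sum of the u j for j >= s, where each u j is homogeneous of
   degree j: the coefficient at m then only receives contributions from
   j = mdeg m, so the terms with j > mdeg m may be omitted. *)
Definition fvf_sum_from (s : nat) (u : nat -> fvf K n) : fvf K n :=
  \col_i FPS (fun m => \sum_(s <= j < (mdeg m).+1) u j i 0 m).

Definition jacobian f : 'M[fps K n]_n := \matrix_(i, j) fps_deriv j (f i 0).

Definition lie_bracket f g : fvf K n := jacobian g *m f - jacobian f *m g.

End FormalVectorFields.

Variant real_or_complex := RealCase | ComplexCase.

Definition scalars (R : realType) (c : real_or_complex) : fieldType :=
  match c with RealCase => R | ComplexCase => R[i] end.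

Definition to_complex (R : realType) (c : real_or_complex) :
    {rmorphism scalars R c -> R[i]} :=
  match c return {rmorphism scalars R c -> R[i]} with
  | RealCase => real_complex R
  | ComplexCase => idfun
  end.

(* [lam] lists all complex eigenvalues, with algebraic multiplicity. *)
Definition eigenvalues (R : realType) (c : real_or_complex) (n : nat)
    (A : 'M[scalars R c]_n) (lam : 'I_n -> R[i]) : Prop :=
  char_poly (map_mx (to_complex R c) A) = \prod_(i < n) ('X - (lam i)%:P).

Definition nonresonant (C : nzRingType) (n : nat) (lam : 'I_n -> C) : Prop :=
  forall (j : 'I_n) (m : 'I_n -> nat),
    (2 <= \sum_i m i)%N -> \sum_i lam i *+ m i - lam j != 0.

(* Main.v *)
(* Writing [D = fps_lie f] for the derivation along [f], one has
   [[beta f, f] = - D beta f], so it suffices to solve [D beta = - alpha].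
   - The constant term of [alpha] vanishes: in degree 1 the equation
     [[g, f] = alpha f] makes the invertible matrix [A] a commutator up to that
     constant.
   - On the series of order at least [d], modulo order greater than [d], [D] is
     annihilated by a product of factors [D - a], where [a = sum_i k_i lam_i]
     with [sum_i k_i = d]: this holds in degree 1 by Cayley-Hamilton and
     propagates to products by the Leibniz rule. Nonresonance gives [a <> 0] for
     [d >= 1], so [D] is onto degree by degree, hence onto the series without
     constant term.
   The second part is done over [R[i]]; over the reals one then takes the real
   part of the solution. *)

Require Import Defs.
From mathcomp Require Import all_boot all_order all_algebra.
From mathcomp Require Import boolp reals complex mpoly ring.

Set Implicit Arguments.
Unset Strict Implicit.
Unset Printing Implicit Defensive.

Import GRing.Theory Num.Theory.

Local Open Scope ring_scope.

(** * Coefficients and partial derivatives of formal power series *)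

Section Coefficients.
Context {K : comNzRingType} {n : nat}.
Implicit Types (p q r : fps K n) (m : 'X_{1..n}) (c : K) (i : 'I_n).

Lemma fcoeff0 m : (0 : fps K n) m = 0.
Proof. by rewrite /= if_same. Qed.

Lemma fcoeffD p q m : (p + q) m = p m + q m.
Proof. by []. Qed.

Lemma fcoeffN p m : (- p) m = - p m.
Proof. by []. Qed.

Lemma fcoeffB p q m : (p - q) m = p m - q m.
Proof. by []. Qed.

Lemma fcoeff_sum (I : Type) (s : seq I) (P : pred I) (F : I -> fps K n) m :
  (\sum_(i <- s | P i) F i) m = \sum_(i <- s | P i) F i m.
Proof.
by apply: (big_morph (fun p => fcoeff p m)) => [p q|]; rewrite ?fcoeff0.
Qed.

Lemma fcoeffM p q m : (p * q) m =
  \sum_(k : 'X_{1..n < (mdeg m).+1, (mdeg m).+1} | m == (k.1 + k.2)%MM)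
    p k.1 * q k.2.
Proof. by []. Qed.

Lemma fcoeffM0 p q : (p * q) 0%MM = p 0%MM * q 0%MM.
Proof.
rewrite [LHS](@fps_mul_eq _ _ _ _ (p 0%MM)%:MP (q 0%MM)%:MP).
- by rewrite -mpolyCM mcoeffC eqxx mulr1.
- move=> k; rewrite mdeg0 leqn0 mdeg_eq0 => /eqP->.
  by rewrite mcoeffC eqxx mulr1.
- move=> k; rewrite mdeg0 leqn0 mdeg_eq0 => /eqP->.
  by rewrite mcoeffC eqxx mulr1.
Qed.

Lemma fcoeffCM c p m : (fpsC c * p) m = c * p m.
Proof.
rewrite [LHS](@fps_mul_eq _ _ _ _ c%:MP (fps_trunc (mdeg m).+1 p)).
- by rewrite mcoeffCM mcoeff_fps_trunc.
- by move=> k _; rewrite mcoeffC /= eq_sym; case: eqP; rewrite ?mulr1 ?mulr0.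
- by move=> k km; apply: mcoeff_fps_trunc.
Qed.

Lemma fpsCM c d : fpsC (c * d) = fpsC c * fpsC d :> fps K n.
Proof.
by apply/fpsP => m; rewrite fcoeffCM /=; case: eqP; rewrite ?mulr0.
Qed.

Lemma fpsCD c d : fpsC (c + d) = fpsC c + fpsC d :> fps K n.
Proof. by apply/fpsP => m /=; case: eqP; rewrite ?addr0. Qed.

Lemma fpsCN c : fpsC (- c) = - fpsC c :> fps K n.
Proof. by apply/fpsP => m /=; case: eqP; rewrite ?oppr0. Qed.

Lemma fcoeffXM0 i p m : m i = 0%N -> (fpsX i * p) m = 0.
Proof.
move=> mi; rewrite fcoeffM big1 // => k /eqP mE /=.
case: eqP => [kU|_]; last by rewrite mul0r.
move/(congr1 (fun l : 'X_{1..n} => l i)): mE.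
by rewrite mi mnmDE kU mnm1E eqxx.
Qed.

Lemma fcoeffXMD i p m : (fpsX i * p) (U_(i) + m)%MM = p m.
Proof.
rewrite [LHS](@fps_mul_eq _ _ _ _ 'X_i (fps_trunc (mdeg m).+2 p)).
- by rewrite mulrC mcoeffMX mcoeff_fps_trunc // leqW.
- by move=> k _; rewrite mcoeffX /= eq_sym.
- by move=> k; rewrite mdegD mdeg1 add1n => km; apply: mcoeff_fps_trunc.
Qed.

Lemma fcoeff_derivX i p m : (fpsX i * fps_deriv i p) m = p m *+ m i.
Proof.
have [mi|mi] := posnP (m i); first by rewrite fcoeffXM0 // mi.
have mE : m = (U_(i) + (m - U_(i)))%MM by rewrite addmC submK // lep1mP -lt0n.
rewrite {1}mE fcoeffXMD /= mnmBE mnm1E eqxx subn1 prednK //.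
by rewrite addmC -mE.
Qed.

Lemma fps_derivD i p q : fps_deriv i (p + q) = fps_deriv i p + fps_deriv i q.
Proof. by apply/fpsP => m /=; rewrite mulrnDl. Qed.

Lemma fps_derivC i c : fps_deriv i (fpsC c) = 0.
Proof.
apply/fpsP => m; rewrite fcoeff0 /= -mdeg_eq0 mdegD mdeg1 addn1.
by rewrite mul0rn.
Qed.

(** The coefficients compared at [m] involve only terms of degree at most [mdeg m + 1], so the rule
    is inherited from polynomial truncations. *)
Lemma fps_derivM i p q :
  fps_deriv i (p * q) = fps_deriv i p * q + p * fps_deriv i q.
Proof.
apply/fpsP => m; pose t (r : fps K n) := fps_trunc (mdeg m).+2 r.
have tE r k : (mdeg k <= (mdeg m).+1)%N -> (t r)@_k = r k.
  by move=> km; rewrite mcoeff_fps_trunc.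
have tdE r k : (mdeg k <= mdeg m)%N -> (t r)^`M(i)@_k = fps_deriv i r k.
  by move=> km; rewrite mcoeff_mderiv tE // mdegD mdeg1 addn1.
rewrite fcoeffD [X in X + _](@fps_mul_eq _ _ _ _ (t p)^`M(i) (t q)); first last.
- by move=> k km; rewrite tE // leqW.
- exact: tdE.
rewrite [X in _ + X](@fps_mul_eq _ _ _ _ (t p) (t q)^`M(i)); first last.
- exact: tdE.
- by move=> k km; rewrite tE // leqW.
rewrite -mcoeffD -mderivM mcoeff_mderiv /=; congr (_ *+ _).
by apply: fps_mul_trunc; rewrite mdegD mdeg1 addn1.
Qed.

Lemma fps_derivX i j : fps_deriv i (fpsX j : fps K n) = (i == j)%:R.
Proof.
apply/fpsP => m; rewrite /= -[U_(j)%MM]add0m.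
have -> : ((i == j)%:R : fps K n) m = ((i == j) && (m == 0%MM))%:R.
  by case: (i == j); rewrite /= ?if_same //; case: (m == 0%MM).
have [<-|ij] /= := eqVneq i j.
  rewrite eqm_add2r; case: eqP => [->|_]; last by rewrite mul0rn.
  by rewrite mnm0E.
case: eqP => [/mnmP/(_ i)|_]; last by rewrite mul0rn.
by rewrite !mnmDE !mnm1E eqxx eq_sym (negPf ij) mnm0E addn1.
Qed.

End Coefficients.

(** * The order filtration and the derivation along a vector field *)

Section LieDerivative.
Context {K : comNzRingType} {n : nat}.
Implicit Types (p q r : fps K n) (f g h : fvf K n) (m : 'X_{1..n}) (c : K).

Definition order_ge (d : nat) p : Prop := forall m, (mdeg m < d)%N -> p m = 0.

Lemma order_ge0 d : order_ge d 0.
Proof. by move=> m _; rewrite fcoeff0. Qed.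

Lemma order_ge_leq d e p : (d <= e)%N -> order_ge e p -> order_ge d p.
Proof. by move=> de hp m md; apply: hp; apply: leq_trans de. Qed.

Lemma order_geD d p q : order_ge d p -> order_ge d q -> order_ge d (p + q).
Proof. by move=> hp hq m md; rewrite fcoeffD hp ?hq ?addr0. Qed.

Lemma order_geN d p : order_ge d p -> order_ge d (- p).
Proof. by move=> hp m md; rewrite fcoeffN hp ?oppr0. Qed.

Lemma order_geB d p q : order_ge d p -> order_ge d q -> order_ge d (p - q).
Proof. by move=> hp hq; apply/order_geD/order_geN. Qed.

Lemma order_ge_sum d (I : Type) (s : seq I) (P : pred I) (F : I -> fps K n) :
  (forall i, P i -> order_ge d (F i)) -> order_ge d (\sum_(i <- s | P i) F i).
Proof.
by apply: (big_ind (order_ge d)); [apply: order_ge0 | apply: order_geD].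
Qed.

Lemma order_geM d e p q :
  order_ge d p -> order_ge e q -> order_ge (d + e) (p * q).
Proof.
move=> hp hq m md; rewrite fcoeffM big1 // => k /eqP mE.
have kd : (mdeg k.1 + mdeg k.2 < d + e)%N by rewrite -mdegD -mE.
have [k1d|dk1] := ltnP (mdeg k.1) d; first by rewrite hp ?mul0r.
by rewrite hq ?mulr0 // -(ltn_add2l d) (leq_ltn_trans _ kd) // leq_add2r.
Qed.

Lemma order_geCM d c p : order_ge d p -> order_ge d (fpsC c * p).
Proof. by move=> hp m md; rewrite fcoeffCM hp ?mulr0. Qed.

Lemma order_ge1P p : order_ge 1 p <-> p 0%MM = 0.
Proof.
split=> [-> //|p0 m]; first by rewrite mdeg0.
by rewrite ltnS leqn0 mdeg_eq0 => /eqP->.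
Qed.

Lemma order_geX i : order_ge 1 (fpsX i : fps K n).
Proof. by apply/order_ge1P => /=; rewrite eq_sym -mdeg_eq0 mdeg1. Qed.

Lemma order_ge_deriv d i p : order_ge d.+1 p -> order_ge d (fps_deriv i p).
Proof. by move=> hp m md; rewrite /= hp ?mul0rn // mdegD mdeg1 addn1. Qed.

Definition fps_lie f p : fps K n := \sum_i fps_deriv i p * f i 0.

Lemma fps_lieD f p q : fps_lie f (p + q) = fps_lie f p + fps_lie f q.
Proof.
by rewrite -big_split; apply: eq_bigr => i _; rewrite fps_derivD mulrDl.
Qed.

Lemma fps_lieM f p q : fps_lie f (p * q) = fps_lie f p * q + p * fps_lie f q.
Proof.
rewrite mulr_suml mulr_sumr -big_split; apply: eq_bigr => i _ /=.
by rewrite fps_derivM; ring.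
Qed.

Lemma fps_lieC f c : fps_lie f (fpsC c) = 0.
Proof. by rewrite /fps_lie big1 // => i _; rewrite fps_derivC mul0r. Qed.

Lemma fps_lieCM f c p : fps_lie f (fpsC c * p) = fpsC c * fps_lie f p.
Proof. by rewrite fps_lieM fps_lieC mul0r add0r. Qed.

Lemma fps_lie0 f : fps_lie f 0 = 0.
Proof. exact: fps_lieC. Qed.

Lemma fps_lieN f p : fps_lie f (- p) = - fps_lie f p.
Proof. by apply/eqP; rewrite -addr_eq0 -fps_lieD addNr fps_lie0. Qed.

Lemma fps_lieB f p q : fps_lie f (p - q) = fps_lie f p - fps_lie f q.
Proof. by rewrite fps_lieD fps_lieN. Qed.

Lemma fps_lieX f i : fps_lie f (fpsX i) = f i 0.
Proof.
rewrite /fps_lie (bigD1 i) //= big1 => [|j /negPf ji].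
  by rewrite fps_derivX eqxx mul1r addr0.
by rewrite fps_derivX ji mul0r.
Qed.

Lemma lie_bracketE f g i :
  lie_bracket f g i 0 = fps_lie f (g i 0) - fps_lie g (f i 0).
Proof.
by rewrite !mxE; congr (_ - _); apply: eq_bigr => j _; rewrite !mxE.
Qed.

(** The terms [p * fps_lie f (f i 0)] from the two halves of the bracket cancel; only the Leibniz
    term differentiating [p] survives. *)
Lemma lie_bracket_subZ f g p :
  lie_bracket (g - p *: f) f = lie_bracket g f + fps_lie f p *: f.
Proof.
apply/matrixP => i j; rewrite ord1 !lie_bracketE [RHS]mxE lie_bracketE !mxE.
have -> q : fps_lie (g - p *: f) q = fps_lie g q - p * fps_lie f q.
  rewrite mulr_sumr -sumrB; apply: eq_bigr => k _.
  by rewrite !mxE; ring.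
by rewrite fps_lieB fps_lieM; ring.
Qed.

(** * Killing leading terms by products of shifted derivations *)

Section VanishingAtOrigin.
Context {f : fvf K n} (f0 : forall i, order_ge 1 (f i 0)).

(** Differentiation loses one order, and the factor [f i 0] restores it. *)
Lemma order_ge_lie d p : order_ge d p -> order_ge d (fps_lie f p).
Proof.
case: d => [|d] hp; first by move=> m; rewrite ltn0.
apply: order_ge_sum => i _; rewrite -addn1.
by apply: order_geM => //; apply: order_ge_deriv.
Qed.

Lemma order_ge_lie_sub d a p :
  order_ge d p -> order_ge d (fps_lie f p - fpsC a * p).
Proof.
by move=> hp; apply: order_geB; [apply: order_ge_lie | apply: order_geCM].
Qed.

(* [ann S d p] says that a product of operators [fps_lie f - a] with [a] in
   [S] sends [p] to order greater than [d]. *)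
Inductive ann (S : K -> Prop) (d : nat) : fps K n -> Prop :=
| ann_small p : order_ge d.+1 p -> ann S d p
| ann_step a p : S a -> ann S d (fps_lie f p - fpsC a * p) -> ann S d p.

Lemma annCM S d c p : ann S d p -> ann S d (fpsC c * p).
Proof.
move=> hp; elim: hp => [{}p hp|a {}p Sa _ IH].
  by apply: ann_small; apply: order_geCM.
by apply: (ann_step Sa); rewrite fps_lieCM; move: IH; rewrite mulrBr mulrCA.
Qed.

(** The operators $D-a$ and $D-b$ commute. *)
Lemma ann_shift S d a p : ann S d p -> ann S d (fps_lie f p - fpsC a * p).
Proof.
move=> hp; elim: hp => [{}p hp|b {}p Sb _ IH].
  exact/ann_small/order_ge_lie_sub.
apply: (ann_step Sb); move: IH.
by congr (ann _ _ _); rewrite !fps_lieB !fps_lieCM; ring.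
Qed.

(** The factors for [p] and for [q] are applied one after the other to the sum; by [ann_shift],
    those meant for one summand do no harm to the other. *)
Lemma annD S d p q : ann S d p -> ann S d q -> ann S d (p + q).
Proof.
move=> hp; elim: hp q => [{}p hp q hq|a {}p Sa _ IH q hq].
  elim: hq p hp => [{}q hq p hp|a {}q Sa _ IH p hp].
    by apply: ann_small; apply: order_geD.
  apply: (ann_step Sa).
  by have := IH _ (order_ge_lie_sub a hp); congr (ann _ _ _); rewrite fps_lieD; ring.
apply: (ann_step Sa); have := IH _ (ann_shift a hq).
by congr (ann _ _ _); rewrite fps_lieD; ring.
Qed.

Lemma ann_sum S d (I : Type) (s : seq I) (P : pred I) (F : I -> fps K n) :
  (forall i, P i -> ann S d (F i)) -> ann S d (\sum_(i <- s | P i) F i).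
Proof.
by apply: (big_ind (ann S d)); [apply/ann_small/order_ge0 | apply: annD].
Qed.

(* The Leibniz rule
   [(D - (a + b)) (p q) = ((D - a) p) q + p ((D - b) q)]. *)
Lemma annM S T U d e p q :
    (forall a b, S a -> T b -> U (a + b)) ->
    order_ge d p -> order_ge e q -> ann S d p -> ann T e q ->
  ann U (d + e) (p * q).
Proof.
move=> SU hp hq hpS.
elim: hpS q hp hq => [{}p hp q _ hq _|a {}p Sa pS IHp q hp hq hqT].
  by apply: ann_small; rewrite -addSn; apply: order_geM.
elim: hqT hq => [{}q hq _|b {}q Tb qT IHq hq].
  by apply: ann_small; rewrite -addnS; apply: order_geM.
apply: (ann_step (SU _ _ Sa Tb)).
(* Each Leibniz term has used up one factor, of [p] or of [q], which is what the nested inductions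
   consume. *)
have := annD (IHp q (order_ge_lie_sub a hp) hq (ann_step Tb qT))
  (IHq (order_ge_lie_sub b hq)).
by congr (ann _ _ _); rewrite fps_lieM fpsCD; ring.
Qed.

End VanishingAtOrigin.
End LieDerivative.

(** Cayley-Hamilton, phrased one factor at a time so that each factor can become one [ann_step]. *)
Lemma foldl_mul_char_poly (F : fieldType) (n : nat) (A : 'M[F]_n)
    (lam : 'I_n -> F) (u : 'rV[F]_n) :
    char_poly A = \prod_(i < n) ('X - (lam i)%:P) ->
  foldl (fun v i => v *m (A - (lam i)%:M)) u (index_enum 'I_n) = 0.
Proof.
case: n A lam u => [|n] A lam u Aeig; first exact: thinmx0.
have foldlE s : foldl (fun v i => v *m (A - (lam i)%:M)) u s =
    u *m \prod_(i <- s) (A - (lam i)%:M).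
  elim: s u => [|i s IHs] v /=; first by rewrite big_nil mulmx1.
  by rewrite IHs big_cons -mulmxE mulmxA.
rewrite foldlE; have := Cayley_Hamilton A; rewrite Aeig rmorph_prod /= => CH.
rewrite -[RHS](mulmx0 _ u) -CH; congr (_ *m _); apply: eq_bigr => i _.
by rewrite rmorphB /= horner_mx_X horner_mx_C.
Qed.

(** * Solving $Dq=p$ for series without constant term *)

Section Surjectivity.
Context {F : numFieldType} {n : nat}.
Implicit Types (p q : fps F n) (m : 'X_{1..n}) (u : 'rV[F]_n).

Definition linear_form u : fps F n := \sum_i fpsC (u 0 i) * fpsX i.

Lemma linear_form_delta i : linear_form (delta_mx 0 i) = fpsX i.
Proof.
rewrite /linear_form (bigD1 i) //= big1 => [|j /negPf ji]; rewrite mxE eqxx.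
  by rewrite eqxx addr0 [LHS]mul1r.
by rewrite ji; apply: mul0r.
Qed.

Lemma fcoeff_linear_form1 u i : linear_form u U_(i)%MM = u 0 i.
Proof.
rewrite fcoeff_sum (bigD1 i) // big1 => [|j /negPf ji].
  by rewrite [LHS]addr0 fcoeffCM /= eqxx mulr1.
rewrite fcoeffCM /=; case: eqP => [/mnmP/(_ j)|]; last by rewrite mulr0.
by rewrite !mnm1E eqxx eq_sym ji.
Qed.

Lemma order_ge_linear_form u : order_ge 1 (linear_form u).
Proof. by apply: order_ge_sum => i _; apply/order_geCM/order_geX. Qed.

Lemma order_ge2P p :
  order_ge 2 p <-> order_ge 1 p /\ forall i, p U_(i)%MM = 0.
Proof.
split=> [hp|[hp1 hpU] m].
  by split=> [|i]; [apply: order_ge_leq hp | apply: hp; rewrite mdeg1].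
rewrite ltnS leq_eqVlt => /orP[/mdeg1P[i /eqP->]|/hp1 //]; exact: hpU.
Qed.

(** Euler's identity for the homogeneous part of degree [d]. *)
Lemma order_ge_euler d p : order_ge d p ->
  order_ge d.+1 (fpsC d%:R * p - \sum_i fpsX i * fps_deriv i p).
Proof.
move=> hp m; rewrite ltnS leq_eqVlt fcoeffB fcoeffCM fcoeff_sum.
under eq_bigr do rewrite fcoeff_derivX.
rewrite sumrMnr -mdegE => /orP[/eqP<-|/hp->].
  by rewrite mulr_natl subrr.
by rewrite mulr0 mul0rn subr0.
Qed.

(** For [lam] the eigenvalues of the linear part of [f], these are the eigenvalues of $D$ on series
    of order at least [d] modulo higher order. *)
Definition weight (lam : 'I_n -> F) (d : nat) (a : F) : Prop :=
  exists2 k : 'I_n -> nat, \sum_i k i = d & a = \sum_i lam i *+ k i.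

Lemma weightD lam d e a b :
  weight lam d a -> weight lam e b -> weight lam (d + e) (a + b).
Proof.
move=> [k <- ->] [l <- ->]; exists (fun i => k i + l i)%N.
  by rewrite big_split.
by rewrite -big_split; apply: eq_bigr => i _; rewrite mulrnDr.
Qed.

Lemma weight0 lam : weight lam 0 0.
Proof.
by exists (fun=> 0%N); rewrite big1 //= => i _; rewrite mulr0n.
Qed.

Lemma weight1 lam i : weight lam 1 (lam i).
Proof.
exists (fun j => (j == i) : nat).
  by rewrite (bigD1 i) //= eqxx big1 ?addn0 // => j /negPf->.
by rewrite (bigD1 i) //= eqxx big1 ?addr0 // => j /negPf->.
Qed.

Context {f : fvf F n} (f0 : forall i, order_ge 1 (f i 0)).

Let A : 'M[F]_n := \matrix_(i, j) f i 0 U_(j)%MM.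

(** Since $Dx_i=f_i$, modulo order 2 the derivation acts on linear forms as $u\mapsto uA$. *)
Lemma fps_lie_linear_form u a :
  order_ge 2 (fps_lie f (linear_form u) - fpsC a * linear_form u
              - linear_form (u *m (A - a%:M))).
Proof.
have lieE : fps_lie f (linear_form u) = \sum_i fpsC (u 0 i) * f i 0.
  rewrite /linear_form (big_morph _ (fps_lieD f) (fps_lie0 f)).
  by apply: eq_bigr => i _; rewrite fps_lieCM fps_lieX.
apply/order_ge2P; split=> [|j].
  do 2?[apply: order_geB]; rewrite ?lieE; try exact: order_ge_linear_form.
    by apply: order_ge_sum => i _; apply: order_geCM.
  exact/order_geCM/order_ge_linear_form.
rewrite !fcoeffB lieE fcoeff_sum fcoeffCM !fcoeff_linear_form1 mulmxBr.
rewrite mul_mx_scalar !mxE; set s := \sum_i _; set t := \sum_i _.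
suff -> : s = t by rewrite subrr.
by apply: eq_bigr => i _; rewrite fcoeffCM mxE.
Qed.

Context {lam : 'I_n -> F}.
Hypothesis A_eig : char_poly A = \prod_(i < n) ('X - (lam i)%:P).

Lemma ann_linear_form u : ann (f := f) (weight lam 1) 1 (linear_form u).
Proof.
have := foldl_mul_char_poly u A_eig; elim: index_enum u => [|i s IHs] u /=.
  move=> ->; apply: ann_small; rewrite /linear_form big1 => [|i _].
    exact: order_ge0.
  by rewrite mxE; apply: mul0r.
move=> /IHs us; apply: (ann_step (weight1 lam i)).
have := annD f0 us (ann_small _ (fps_lie_linear_form u (lam i))).
by rewrite addrC subrK.
Qed.

(** Induction on the degree: by Euler's identity, [p] is up to higher order a multiple of $\sum_i
    x_i\,\partial_i p$, and [annM] handles each product. *)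
Lemma ann_weight d p : order_ge d p -> ann (f := f) (weight lam d) d p.
Proof.
elim: d p => [|d IHd] p hp.
  (* In degree 0 the single factor $D-0$ suffices, every term of $Dp$ containing some [f i 0]. *)
  apply: (ann_step (weight0 lam)); apply: ann_small.
  rewrite [fpsC 0 * p]mul0r subr0.
  apply: order_ge_sum => i _; exact: (@order_geM _ _ 0 1).
set q := \sum_i fpsX i * fps_deriv i p.
have -> : p = fpsC d.+1%:R^-1 * (q + (fpsC d.+1%:R * p - q)).
  by rewrite addrC subrK mulrA -fpsCM mulVf ?pnatr_eq0 // [RHS]mul1r.
apply: annCM; apply: annD => //; last exact/ann_small/order_ge_euler.
apply: ann_sum => // i _; rewrite -add1n; apply: annM (IHd _ _) => //.
- exact: weightD.
- exact: order_geX.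
- exact: order_ge_deriv.
- by rewrite -linear_form_delta; apply: ann_linear_form.
- exact: order_ge_deriv.
Qed.

(** If [q] solves the problem for $(D-a)p$, then $a^{-1}(p-q)$ solves it for $p$, because
    $D(p-q)=ap+((D-a)p-Dq)$. *)
Lemma ann_solve (S : F -> Prop) d p : (forall a, S a -> a != 0) ->
    order_ge d p -> ann (f := f) S d p ->
  exists2 q, order_ge d q & order_ge d.+1 (p - fps_lie f q).
Proof.
move=> S0 hp hpS; elim: hpS hp => [{}p hp _|a {}p Sa _ IH hp].
  by exists 0; rewrite ?fps_lie0 ?subr0 //; apply: order_ge0.
have [q hq hpq] := IH (order_ge_lie_sub f0 a hp).
exists (fpsC a^-1 * (p - q)); first exact/order_geCM/order_geB.
have -> : p - fps_lie f (fpsC a^-1 * (p - q)) =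
    fpsC (- a^-1) * (fps_lie f p - fpsC a * p - fps_lie f q).
  rewrite fps_lieCM fps_lieB fpsCN.
  rewrite -[X in X - _]mul1r -[1]/(fpsC 1) -(mulVf (S0 _ Sa)) fpsCM; ring.
exact: order_geCM.
Qed.

Hypothesis lam_weight : forall d a, weight lam d.+1 a -> a != 0.

(** Successive approximation: each correction raises the order of the residue by one and has itself
    high enough order for the limit to exist. *)
Lemma fps_lie_surj p : order_ge 1 p -> exists q, fps_lie f q = p.
Proof.
move=> hp.
(* The condition on the residue stands under the existential so that [next] is total; where it
   fails, the value 0 is arbitrary. *)
have /choice[next nextP] (x : nat * fps F n) : exists q,
    order_ge x.1.+1 (p - fps_lie f x.2) ->
    order_ge x.1.+1 (q - x.2) /\ order_ge x.1.+2 (p - fps_lie f q).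
  case: x => d q /=.
  have [hq|] := pselect (order_ge d.+1 (p - fps_lie f q)); last by exists 0.
  have [r hr hqr] := ann_solve (@lam_weight d) hq (ann_weight hq).
  exists (q + r) => _; split; first by rewrite addrC addKr.
  by move: hqr; congr order_ge; rewrite fps_lieD; ring.
pose Q := fix Q d := if d is e.+1 then next (e, Q e) else 0.
have Qp d : order_ge d.+1 (p - fps_lie f (Q d)).
  elim: d => [|d /(nextP (_, _))[] //].
  by rewrite fps_lie0 subr0.
have QS d : order_ge d.+1 (Q d.+1 - Q d) by have [] := nextP (d, Q d) (Qp d).
have QE d e m : (mdeg m <= d)%N -> (d <= e)%N -> Q e m = Q d m.
  move=> md; elim: e => [|e IHe]; first by rewrite leqn0 => /eqP->.
  rewrite leq_eqVlt => /orP[/eqP->//|de]; rewrite -IHe //; apply/eqP.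
  by rewrite -subr_eq0 -fcoeffB QS // ltnS (leq_trans md).
(* By [QE] the coefficient at [m] is constant from stage [mdeg m] on, so this diagonal is the
   limit. *)
pose q := FPS (fun m => Q (mdeg m) m).
have qQ d : order_ge d.+1 (q - Q d).
  by move=> m md; rewrite fcoeffB /= (QE (mdeg m) d) ?subrr.
exists q; apply/fpsP => m; apply/eqP; rewrite eq_sym -subr_eq0 -fcoeffB.
have -> : p - fps_lie f q = p - fps_lie f (Q (mdeg m))
                            - fps_lie f (q - Q (mdeg m)).
  by rewrite fps_lieB; ring.
by apply/eqP; apply: (order_geB (Qp (mdeg m)) (order_ge_lie f0 (qQ (mdeg m)))).
Qed.

End Surjectivity.

(** * Linear parts and the constant term of [alpha] *)

Section LinearPart.
Context {K : comNzRingType} {n : nat}.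
Implicit Types (p q : fps K n) (f g : fvf K n).

Definition linear_part f : 'M[K]_n := \matrix_(i, j) f i 0 U_(j)%MM.

Lemma fcoeffM1 p q i :
  (p * q) U_(i)%MM = p U_(i)%MM * q 0%MM + p 0%MM * q U_(i)%MM.
Proof.
have d0 r : fps_deriv i r 0%MM = r U_(i)%MM by rewrite /= add0m mnm0E.
by rewrite -!d0 fps_derivM fcoeffD !fcoeffM0.
Qed.

Lemma fcoeff_lie0 g p :
  fps_lie g p 0%MM = \sum_j p U_(j)%MM * g j 0 0%MM.
Proof.
rewrite fcoeff_sum; apply: eq_bigr => j _.
by rewrite fcoeffM0 /= add0m mnm0E.
Qed.

Lemma fcoeff_lie1 g p k : (forall j, g j 0 0%MM = 0) ->
  fps_lie g p U_(k)%MM = \sum_j p U_(j)%MM * g j 0 U_(k)%MM.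
Proof.
move=> g0; rewrite fcoeff_sum; apply: eq_bigr => j _.
by rewrite fcoeffM1 g0 mulr0 add0r /= add0m mnm0E.
Qed.

End LinearPart.

(* With [A], [B] the linear parts of [f], [g], the terms of degree 1 give
   [A B - B A = a A], where [a] is the constant term of [alpha]; multiplying by
   the inverse of [A] and taking traces gives [n a = 0]. *)
Lemma normalizer_factor_order_ge1 (K : fieldType) (n : nat) (f g : fvf K n)
    (alpha : fps K n) :
    (forall i, order_ge 1 (f i 0)) -> linear_part f \in unitmx ->
    n%:R != 0 :> K -> lie_bracket g f = alpha *: f ->
  order_ge 1 alpha.
Proof.
move=> f1 Aunit n0 gf; apply/order_ge1P.
have f0 i : f i 0 0%MM = 0 by exact/order_ge1P.
have gfi i : fps_lie g (f i 0) - fps_lie f (g i 0) = alpha * f i 0.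
  by rewrite -lie_bracketE gf mxE.
(* In degree 0 the equation reads $A\,g(0)=0$. Once $g(0)=0$, the quadratic part of [f] no longer
   enters in degree 1. *)
have g0 j : g j 0 0%MM = 0.
  pose v : 'cV[K]_n := \col_j g j 0 0%MM.
  suff : v = 0 by move/matrixP/(_ j 0); rewrite !mxE.
  rewrite -[v](mulKmx Aunit).
  suff -> : linear_part f *m v = 0 by rewrite mulmx0.
  apply/matrixP => i k; rewrite !mxE.
  have := congr1 (fun p => fcoeff p 0%MM) (gfi i).
  rewrite fcoeffB fcoeffM0 f0 mulr0 !fcoeff_lie0.
  rewrite [X in _ - X]big1 => [|l _]; last by rewrite f0 mulr0.
  rewrite subr0 => gfi0; rewrite -[RHS]gfi0.
  by apply: eq_bigr => l _; rewrite !mxE.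
have comm : linear_part f *m linear_part g - linear_part g *m linear_part f =
    alpha 0%MM *: linear_part f.
  apply/matrixP => i k; rewrite !mxE.
  have := congr1 (fun p => fcoeff p U_(k)%MM) (gfi i).
  rewrite fcoeffB fcoeffM1 f0 mulr0 add0r !fcoeff_lie1 // => <-.
  by congr (_ - _); apply: eq_bigr => l _; rewrite !mxE.
have /(congr1 mxtrace) := congr1 (mulmx (invmx (linear_part f))) comm.
rewrite mulmxBr mulKmx // mxtraceD raddfN /= mulmxA mxtrace_mulC mulmxA.
rewrite mulmxV // mul1mx subrr -scalemxAr mulVmx // mxtraceZ mxtrace1.
by move/esym/eqP; rewrite mulf_eq0 (negPf n0) orbF => /eqP.
Qed.

(** * Descent of solutions from complex to base scalars *)

Section ScalarExtension.
Context {R : realType} {c : real_or_complex} {n : nat}.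
Local Notation K := (scalars R c).

Definition of_complex : R[i] -> K :=
  match c return R[i] -> scalars R c with
  | RealCase => @complex.Re R
  | ComplexCase => id
  end.

Lemma to_complexK : cancel (to_complex R c) of_complex.
Proof. by rewrite /of_complex; case: c. Qed.

Lemma of_complexD : {morph of_complex : x y / x + y}.
Proof. by rewrite /of_complex; case: c => [[a b] [a' b']|]. Qed.

Lemma of_complexM x (k : K) :
  of_complex (x * to_complex R c k) = of_complex x * k.
Proof.
rewrite /of_complex; case: c k => [k|//]; case: x => a b /=.
by rewrite mulr0 subr0.
Qed.

Definition map_fps (L M : Type) (h : L -> M) (p : fps L n) : fps M n :=
  FPS (fun m => h (p m)).

Definition complexify (f : fvf K n) : fvf R[i] n :=
  map_mx (map_fps (to_complex R c)) f.

(** The coefficients of [complexify f] come from [K], and [of_complex] is linear over [K], although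
    real parts are not multiplicative. *)
Lemma map_fps_of_complex_lie (f : fvf K n) (q : fps R[i] n) :
  map_fps of_complex (fps_lie (complexify f) q) =
  fps_lie f (map_fps of_complex q).
Proof.
have of0 : of_complex 0 = 0 by rewrite -(rmorph0 (to_complex R c)) to_complexK.
have ofMn x k : of_complex (x *+ k) = of_complex x *+ k.
  by elim: k => [|k IHk]; rewrite ?mulr0n // !mulrS of_complexD IHk.
apply/fpsP => m; rewrite fcoeff_sum [LHS]/= fcoeff_sum.
rewrite (big_morph _ of_complexD of0); apply: eq_bigr => i _.
rewrite !fcoeffM (big_morph _ of_complexD of0); apply: eq_bigr => k _.
by rewrite mxE of_complexM /= ofMn.
Qed.

End ScalarExtension.

(** Adding and subtracting some $\lambda_j$ turns a vanishing weight of degree at least 1 into a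
    resonance of total at least 2. *)
Lemma nonresonant_weight (C : numFieldType) (n : nat) (lam : 'I_n -> C) d a :
  nonresonant lam -> weight lam d.+1 a -> a != 0.
Proof.
move=> nonres [k kd ->].
have [j _] : exists j : 'I_n, true.
  by case: n lam nonres k kd => [|n] lam _ k; [rewrite big_ord0 | exists ord0].
have := nonres j (fun i => k i + (i == j))%N.
have sumj : (\sum_i (i == j) = 1)%N.
  by rewrite (bigD1 j) //= eqxx big1 ?addn0 // => i /negPf->.
rewrite big_split /= kd sumj addn1 => /(_ isT).
under eq_bigr do rewrite mulrnDr.
rewrite big_split /= [X in _ + X - _](bigD1 j) //= eqxx mulr1n.
by rewrite [X in _ + (_ + X) - _]big1 ?addr0 ?addrK // => i /negPf->.
Qed.

(** The value at 0 of the characteristic polynomial is, up to sign, the determinant. *)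
Lemma char_poly_prod_unitmx (F : fieldType) (n : nat) (A : 'M[F]_n)
    (lam : 'I_n -> F) :
    char_poly A = \prod_(i < n) ('X - (lam i)%:P) ->
  (forall i, lam i != 0) -> A \in unitmx.
Proof.
move=> Aeig lam0; rewrite unitmxE unitfE.
have := char_poly_det A; rewrite Aeig -horner_coef0 horner_prod => /eqP.
apply: contraTneq => ->; rewrite mulr0 prodf_seq_neq0; apply/allP => i _ /=.
by rewrite hornerXsubC sub0r oppr_eq0.
Qed.

Theorem proposition4p3p9 (R : realType) (c : real_or_complex) (n : nat)
    (A : 'M[scalars R c]_n) (fj : nat -> fvf (scalars R c) n)
    (fj_homog : forall j : nat, (2 <= j)%N -> fvf_homog j (fj j))
    (f : fvf (scalars R c) n)
    (f_def : f = linear_fvf A + fvf_sum_from 2 fj)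
    (lam : 'I_n -> R[i]) (lam_eig : eigenvalues A lam)
    (lam_nonres : nonresonant lam)
    (g : fvf (scalars R c) n) (alpha : fps (scalars R c) n)
    (g_normalizes : lie_bracket g f = alpha *: f) :
  exists (beta : fps (scalars R c) n) (h : fvf (scalars R c) n),
    g = h + beta *: f /\ lie_bracket h f = 0.
Proof.
(* For [n = 0] all fields are equal; otherwise [n] is invertible in the scalars, as the trace
   argument requires. *)
have [n0|n_gt0] := posnP n.
  exists 0, g; split; apply/matrixP => i; have := ltn_ord i; by rewrite {2}n0.
have fE i m : (mdeg m < 2)%N -> f i 0 m = \sum_j A i j * fpsX j m.
  move=> m2; rewrite f_def !mxE fcoeffD [X in _ + X]/= big_geq // addr0.
  by rewrite fcoeff_sum; apply: eq_bigr => j _; rewrite !mxE fcoeffCM.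
have f1 i : order_ge 1 (f i 0).
  move=> m m1; rewrite fE ?(leq_trans m1) // big1 // => j _.
  by rewrite order_geX ?mulr0.
have fA : linear_part f = A.
  apply/matrixP => i j; rewrite mxE fE ?mdeg1 // (bigD1 j) //= eqxx mulr1.
  rewrite big1 ?addr0 // => k /negPf kj; case: eqP => [/mnmP/(_ k)|].
    by rewrite !mnm1E eqxx eq_sym kj.
  by rewrite mulr0.
have weight_neq0 d a := @nonresonant_weight _ n lam d a lam_nonres.
(* A zero eigenvalue would be a vanishing weight of degree 1. Invertibility is checked over [R[i]],
   where the eigenvalues live. *)
have Aunit : A \in unitmx.
  rewrite -(map_unitmx (to_complex R c)).
  apply: char_poly_prod_unitmx lam_eig _.
  by move=> i; apply: (weight_neq0 0%N); apply: weight1.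
have nK0 : n%:R != 0 :> scalars R c.
  by rewrite -(fmorph_eq0 (to_complex R c)) rmorph_nat pnatr_eq0 -lt0n.
have alpha1 : order_ge 1 alpha.
  by apply: normalizer_factor_order_ge1 nK0 g_normalizes; rewrite ?fA.
have [q qE] : exists q, fps_lie (complexify f) q =
    map_fps (to_complex R c) (- alpha).
  apply: (@fps_lie_surj _ _ _ _ lam) => //.
  - by move=> i m m1; rewrite mxE /= f1 ?rmorph0.
  - rewrite -lam_eig; congr char_poly; rewrite -fA.
    by apply/matrixP => i j; rewrite !mxE.
  - by move=> m m1; rewrite /= alpha1 ?oppr0 ?rmorph0.
(* As [f] and [alpha] have coefficients in the base field, the image of the complex solution still
   satisfies $D\beta=-\alpha$. *)
pose beta := map_fps (@of_complex R c) q; exists beta, (g - beta *: f).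
split; first by rewrite subrK.
rewrite lie_bracket_subZ g_normalizes -map_fps_of_complex_lie qE.
have -> : map_fps (@of_complex R c) (map_fps (to_complex R c) (- alpha)) =
    - alpha.
  by apply/fpsP => m; apply: to_complexK.
by rewrite scaleNr subrr.
Qed.
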